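(* Let $G$ be a graph, and let $\Sigma$ be a discrete, crossing-finite, ECC system of separations of $G$. Let $(M,\beta)$ be the median decomposition dual to $\Sigma$. Let $(N,\alpha)$ be another reduced median decomposition of $G$ such that the set of separations $\Sigma_{N,\alpha}$ of $G$ induced by the $\Theta$-classes of $N$ is exactly $\Sigma$. Then there exists a median embedding $\varphi: M\hookrightarrow N$ such that $\alpha\circ\varphi=\beta$. The map $\varphi$ is surjective if and only if $(N,\alpha)$ is crossing-faithful.
   Context: Graphs are simple, undirected, possibly infinite. Separations. A separation of $G$ is an ordered pair $(A,B)$ of subsets of $V(G)$ with $A\cup B=V(G)$ and no edge of $G$ joining $A\setminus B$ to $B\setminus A$. It is essential if $A\ne V(G)$ and $B\neq V(G)$. Its flip is $(A,B)^r=(B,A)$. Separations are partially ordered by $(A,B)\le(C,D)$ iff $A\subseteq C$ and $D\subseteq B$. Two separations are nested if $(A,B)$ is comparable with $(C,D)$ or with $(D,C)$; otherwise they cross. A system of separations is a set $\Sigma$ of essential separations closed under flips. $\Sigma$ is discrete if for all $s_1,s_2\in\Sigma$ the set $\{t\in\Sigma: s_1\le t\le s_2\}$ is finite; crossing-finite if every set of pairwise-crossing elements of $\Sigma$ is finite; ECC (escaping chain condition) if for every infinite strictly descending chain $(A_1,B_1)>(A_2,B_2)>\cdots$ in $\Sigma$ we have $\bigcap_n (A_n\setminus B_n)=\emptyset$. Median graphs. For vertices $u,v$ of a connected graph, $I(u,v)$ is the set of vertices lying on some geodesic (shortest path) from $u$ to $v$. A median graph is a connected graph in which $I(u,v)\cap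 I(v,w)\cap I(w,u)$ is a single vertex (the median of $u,v,w$) for all vertices $u,v,w$. A subgraph $C$ is convex if every geodesic with endpoints in $C$ is contained in $C$. A median embedding of median graphs is an injective map on vertices that preserves adjacency and medians. On the oriented edges of a median graph $M$ define $(x,y)\,\Theta\,(u,v)$ iff $d(x,u)+d(y,v)<d(x,v)+d(y,u)$; this is an equivalence relation, whose classes are the oriented $\Theta$-classes; their set is $\vec{\mathcal H}(M)$. For $\mathfrak h=[(u,v)]$ put $\mathfrak h_+=\{w: d(w,u)<d(w,v)\}$ and $\mathfrak h_-=\{w: d(w,u)>d(w,v)\}$ (independent of the representative). Two oriented $\Theta$-classes $\mathfrak h,\mathfrak h'$ cross if all four sets $\mathfrak h_\pm\cap\mathfrak h'_\pm$ are non-empty. Median decompositions. A median decomposition of $G$ is a pair $(M,\beta)$ with $M$ a median graph and $\beta:V(M)\to\mathcal P(V(G))$ such that (M1) $\bigcup_u\beta(u)=V(G)$; (M2) for every edge $xy$ of $G$ some $\beta(u)$ contains $\{x,y\}$; (M3) for every $v\in V(G)$ the fibre $\beta^{-1}(v)=\{u\in V(M): v\in\beta(u)\}$ induces a convex subgraph of $M$. For $\mathfrak h\in\vec{\mathcal H}(M)$ the separation induced by $\mathfrak h$ is $(A_{\mathfrak h},B_{\mathfrak h})$ with $A_{\mathfrak h}=\bigcup_{u\in\mathfrak h_+}\beta(u)$ and $B_{\mathfrak h}=\bigcup_{u\in\mathfrak h_-}\beta(u)$, and $\Sigma_{M,\beta}=\{(A_{\mathfrak h},B_{\mathfrak h}):\mathfrak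 h\in\vec{\mathcal H}(M)\}$. $(M,\beta)$ is reduced if every $(A_{\mathfrak h},B_{\mathfrak h})$ is essential and the map $\mathfrak h\mapsto(A_{\mathfrak h},B_{\mathfrak h})$ is injective. It is crossing-faithful if whenever $\mathfrak h,\mathfrak h'$ cross, the induced separations also cross. Dual median decomposition. An ultrafilter on $\Sigma$ is a subset $\mathcal U\subseteq\Sigma$ such that for each $s\in\Sigma$ exactly one of $s,s^r$ lies in $\mathcal U$, and $s\in\mathcal U$, $s\le t\in\Sigma$ imply $t\in\mathcal U$. It is DCC if every descending chain in $\mathcal U$ is finite. For $\Sigma$ discrete, crossing-finite and ECC, the graph $M_\Sigma$ has as vertices the DCC ultrafilters on $\Sigma$, with $\mathcal U,\mathcal V$ adjacent iff $|\mathcal U\triangle\mathcal V|=2$; it is a median graph. The median decomposition dual to $\Sigma$ is $(M_\Sigma,\beta)$ where $\beta(\mathcal U)=\bigcap_{(A,B)\in\mathcal U}A$ (interpreted as $V(G)$ if $\Sigma=\emptyset$). *)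

(* Defs.v *)
From Stdlib Require List.
From mathcomp Require Import all_boot.
From mathcomp Require Import boolp classical_sets functions cardinality.

Set Implicit Arguments.
Unset Strict Implicit.
Unset Printing Implicit Defensive.

Local Open Scope classical_set_scope.

(** * Graphs, possibly infinite *)

Record sgraph := SGraph {
  vert :> Type;
  adj : rel vert;
  adj_sym : symmetric adj;
  adj_irr : irreflexive adj }.

Arguments adj {s}.

(** * Separations *)

Definition separation (G : sgraph) : Type := (set G * set G)%type.

Section Separations.
Variable G : sgraph.
Implicit Types (s t : separation G) (Sigma U : set (separation G)).

Definition is_separation s :=
  s.1 `|` s.2 = setT /\
  forall x y, (s.1 `\` s.2) x -> (s.2 `\` s.1) y -> ~~ adj x y.

Definition essential s := s.1 <> setT /\ s.2 <> setT.

Definition flip s : separation G := (s.2, s.1).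

Definition sep_le s t := s.1 `<=` t.1 /\ t.2 `<=` s.2.

Definition sep_lt s t := sep_le s t /\ s <> t.

Definition sep_comparable s t := sep_le s t \/ sep_le t s.

Definition nested s t := sep_comparable s t \/ sep_comparable s (flip t).

Definition sep_cross s t := ~ nested s t.

Definition sep_system Sigma :=
  [/\ forall s, Sigma s -> is_separation s,
      forall s, Sigma s -> essential s &
      forall s, Sigma s -> Sigma (flip s)].

Definition discrete_system Sigma :=
  forall s1 s2, Sigma s1 -> Sigma s2 ->
    finite_set [set t | Sigma t /\ sep_le s1 t /\ sep_le t s2].

(* A separation is nested with itself, so "pairwise" means between distinct
   elements. *)
Definition crossing_finite Sigma :=
  forall X, X `<=` Sigma ->
    (forall s t, X s -> X t -> s <> t -> sep_cross s t) -> finite_set X.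

Definition descending_chain (c : nat -> separation G) :=
  forall n, sep_lt (c n.+1) (c n).

Definition ECC Sigma :=
  forall c, (forall n, Sigma (c n)) -> descending_chain c ->
    \bigcap_n ((c n).1 `\` (c n).2) = set0.

Definition ultrafilter_on Sigma U :=
  [/\ U `<=` Sigma,
      forall s, Sigma s -> (U s \/ U (flip s)) /\ ~ (U s /\ U (flip s)) &
      forall s t, U s -> Sigma t -> sep_le s t -> U t].

Definition DCC U := ~ exists c, (forall n, U (c n)) /\ descending_chain c.

Definition DCC_ultrafilter Sigma U := ultrafilter_on Sigma U /\ DCC U.

End Separations.

(** * Median graphs *)

Section MedianGraphs.
Variable M : sgraph.
Implicit Types (u v w x y : M) (p : seq M).

(* The walk [x :: p]. *)
Definition walk x y p := path adj x p /\ last x p = y.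

(* A walk of minimum length repeats no vertex, so geodesics are shortest
   paths. *)
Definition geodesic x y p :=
  walk x y p /\ forall q, walk x y q -> size p <= size q.

Definition interval u v : set M :=
  [set w | exists p, geodesic u v p /\ List.In w (u :: p)].

(* The default value 0 is only taken when x and y are not connected. *)
Definition dist x y : nat :=
  xget 0 [set n | exists p, geodesic x y p /\ size p = n].

(* Connected graphs are non-empty. *)
Definition connected := (exists x : M, True) /\ forall x y, exists p, walk x y p.

Definition is_median u v w m :=
  interval u v `&` interval v w `&` interval w u = [set m].

Definition median_graph :=
  connected /\ forall u v w, exists m, is_median u v w m.

(* Convexity of the subgraph induced by S. *)
Definition convex (S : set M) :=
  forall x y p, S x -> S y -> geodesic x y p ->
    forall w, List.In w (x :: p) -> S w.

Definition Theta (e f : M * M) : Prop :=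
  dist e.1 f.1 + dist e.2 f.2 < dist e.1 f.2 + dist e.2 f.1.

Definition theta_class (e : M * M) : set (M * M) :=
  [set f | adj f.1 f.2 /\ Theta e f].

Definition theta_classes : set (set (M * M)) :=
  [set theta_class e | e in [set e | adj e.1 e.2]].

(* In a median graph the two half-spaces do not depend on the edge e chosen
   in the class h. *)
Definition pos (h : set (M * M)) : set M :=
  [set w | exists e, h e /\ dist w e.1 < dist w e.2].

Definition neg (h : set (M * M)) : set M :=
  [set w | exists e, h e /\ dist w e.1 > dist w e.2].

Definition theta_cross (h k : set (M * M)) :=
  [/\ pos h `&` pos k !=set0, pos h `&` neg k !=set0,
      neg h `&` pos k !=set0 & neg h `&` neg k !=set0].

End MedianGraphs.

Definition median_embedding (M N : sgraph) (phi : M -> N) :=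
  [/\ median_graph M, median_graph N, injective phi,
      forall x y, adj x y -> adj (phi x) (phi y) &
      forall u v w m, is_median u v w m ->
        is_median (phi u) (phi v) (phi w) (phi m)].

(** * Median decompositions *)

Section MedianDecompositions.
Variables (G M : sgraph) (beta : M -> set G).

Definition median_decomposition :=
  [/\ median_graph M,
      \bigcup_u beta u = setT,
      forall x y : G, adj x y -> exists u, beta u x /\ beta u y &
      forall v : G, convex [set u | beta u v]].

Definition induced_sep (h : set (M * M)) : separation G :=
  (\bigcup_(u in pos h) beta u, \bigcup_(u in neg h) beta u).

Definition induced_seps : set (separation G) :=
  [set induced_sep h | h in @theta_classes M].

Definition reduced :=
  (forall h, theta_classes h -> essential (induced_sep h)) /\
  (forall h k, theta_classes h -> theta_classes k ->
     induced_sep h = induced_sep k -> h = k).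

Definition crossing_faithful :=
  forall h k, theta_classes h -> theta_classes k -> theta_cross h k ->
    sep_cross (induced_sep h) (induced_sep k).

End MedianDecompositions.

(** * The dual median decomposition *)

Section Dual.
Variables (G : sgraph) (Sigma : set (separation G)).

Definition dual_vert : Type :=
  {U : set (separation G) | DCC_ultrafilter Sigma U}.

Definition dual_adj : rel dual_vert :=
  fun U W => (sval U `+` sval W #= `I_2)%card.

Lemma dual_adj_sym : symmetric dual_adj.
Proof. by move=> U W; rewrite /dual_adj setYC. Qed.

Lemma dual_adj_irr : irreflexive dual_adj.
Proof.
move=> U; rewrite /dual_adj setYK card_eq_sym card_eq0.
by apply/negP => /eqP/seteqP[/(_ 0 isT)].
Qed.

Definition dual_graph : sgraph := SGraph dual_adj_sym dual_adj_irr.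

Definition dual_bag (U : dual_graph) : set G := \bigcap_(s in sval U) s.1.

End Dual.

(* Main.v *)
Require Import Defs.
From mathcomp Require Import all_boot finmap zify.
From mathcomp Require Import boolp classical_sets functions cardinality.

(** Every separation s in Sigma is induced by a unique half-space [side s] of N.  For a
    DCC ultrafilter U on Sigma, the half-spaces [side s] with s in U pairwise meet, since
    [side s] and [side t] being disjoint would give s <= flip t.  They have a common
    vertex phi U.  The crux is that, for a vertex x, only finitely many s in U have x on
    the wrong side: by crossing-finiteness an infinite set of them has a member s
    comparable, up to flips, to infinitely many t.  If s <= t or flip s <= t infinitely
    often, then a bag containing a vertex of G private to one side of s sits at finite
    distance from x but is separated from x infinitely often; otherwise t <= s infinitely
    often, and iterating contradicts DCC.  Moving x one step towards the nearest vertex of a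
    misoriented half-space strictly decreases the number of misoriented half-spaces.

    Flipping minimal elements of ultrafilters shows that phi is isometric.  In both graphs,
    w lies on a geodesic from u to v iff w lies in every half-space containing u and v,
    so majorities of ultrafilters are medians, and phi preserves them.  The vertex x is in
    the image of phi iff the half-spaces containing x form an ultrafilter on Sigma, which
    can only fail if two half-spaces cross while their separations are nested. *)

Set Implicit Arguments.
Unset Strict Implicit.
Unset Printing Implicit Defensive.

Local Open Scope classical_set_scope.

(** * Distances and half-spaces *)

Section Distance.
Variable M : sgraph.
Hypothesis M_conn : connected M.
Implicit Types (u v w x y z : M) (p q : seq M).

Lemma geodesic_exists x y : exists p, geodesic x y p.
Proof.
have [p0 p0P] := M_conn.2 x y.
have ex : exists n, `[< exists p, walk x y p /\ size p = n >].
  by exists (size p0); apply/asboolP; exists p0.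
case: (ex_minnP ex) => n /asboolP[p [pP <-]] nmin.
by exists p; split=> // q qP; apply: nmin; apply/asboolP; exists q.
Qed.

Lemma dist_geodesic x y p : geodesic x y p -> size p = dist x y.
Proof.
move=> pP; rewrite /dist; case: xgetP => [n _ [q [qP <-]]|no].
  by apply/eqP; rewrite eqn_leq (pP.2 _ qP.1) (qP.2 _ pP.1).
by case: (no (size p)); exists p.
Qed.

Lemma dist_walk x y : exists2 p, walk x y p & size p = dist x y.
Proof.
by have [p pP] := geodesic_exists x y; exists p; [exact: pP.1 | exact: dist_geodesic].
Qed.

Lemma dist_le_size x y p : walk x y p -> dist x y <= size p.
Proof.
by move=> pP; have [q qP] := geodesic_exists x y; rewrite -(dist_geodesic qP) qP.2.
Qed.

Lemma walk_geodesic x y p : walk x y p -> size p = dist x y -> geodesic x y p.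
Proof. by move=> pP szp; split=> // q /dist_le_size; rewrite szp. Qed.

Lemma walk_cat x y z p q : walk x y p -> walk y z q -> walk x z (p ++ q).
Proof.
by move=> [pp lp] [pq lq]; rewrite /walk cat_path last_cat lp pp pq.
Qed.

Lemma walk_rev x y p : walk x y p -> walk y x (rev (belast x p)).
Proof.
move=> [pp lp]; split.
  by rewrite -lp rev_path (eq_path (e' := adj))// => u v; rewrite adj_sym.
by case: p {pp} lp => [|a p] //=; rewrite rev_cons last_rcons.
Qed.

Lemma distC x y : dist x y = dist y x.
Proof.
suff le u v : dist u v <= dist v u by apply/eqP; rewrite eqn_leq !le.
have [p pP <-] := dist_walk v u.
by rewrite (leq_trans (dist_le_size (walk_rev pP)))// size_rev size_belast.
Qed.

Lemma dist_triangle y x z : dist x z <= dist x y + dist y z.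
Proof.
have [p pP <-] := dist_walk x y; have [q qP <-] := dist_walk y z.
by rewrite -size_cat dist_le_size//; apply: walk_cat pP qP.
Qed.

Lemma distxx x : dist x x = 0.
Proof. by apply/eqP; rewrite -leqn0 (@dist_le_size x x [::]). Qed.

Lemma dist_eq0 x y : dist x y = 0 -> x = y.
Proof. by have [p [_ <-] <-] := dist_walk x y; case: p. Qed.

Lemma adj_neq x y : adj x y -> x <> y.
Proof. by move=> + xy; rewrite xy adj_irr. Qed.

Lemma adj_dist x y : adj x y -> dist x y = 1.
Proof.
move=> xy; have: dist x y <= 1 by apply: (@dist_le_size x y [:: y]); rewrite /walk /= xy.
by case E: (dist x y) => [|[]]//; case: (adj_neq xy); apply: dist_eq0.
Qed.

Lemma dist_step x y : x <> y -> exists2 z, adj x z & dist x y = (dist z y).+1.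
Proof.
move=> xy; have [[|z p] [/= pp lp] szp] := dist_walk x y; first by [].
have /andP[xz pz] := pp; exists z => //.
apply/eqP; rewrite eqn_leq -{2}szp /= ltnS dist_le_size// andbT.
by have := dist_triangle z x y; rewrite (adj_dist xz) add1n.
Qed.

Lemma dist_eq1 x y : dist x y = 1 -> adj x y.
Proof.
move=> xy; have [z xz] : exists2 z, adj x z & dist x y = (dist z y).+1.
  by apply: dist_step => E; rewrite E distxx in xy.
by rewrite xy => -[] /esym/dist_eq0 <-.
Qed.

Lemma walk_split x y w p : walk x y p -> List.In w (x :: p) ->
  exists q r, [/\ walk x w q, walk w y r & p = q ++ r].
Proof.
elim: p x => [|a p IH] x [/= pp lp] [<-|wp] //.
- by exists [::], [::].
- by exists [::], (a :: p).
- case/andP: pp => xa pa; have [q [r [[pq lq] wr ->]]] := IH a (conj pa lp) wp.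
  by exists (a :: q), r; split=> //; rewrite /walk /= xa.
Qed.

Lemma last_In x p : List.In (last x p) (x :: p).
Proof. by elim: p x => [|a p IH] x /=; [left | right; apply: IH]. Qed.

Lemma intervalE u v w : interval u v w <-> dist u w + dist w v = dist u v.
Proof.
split=> [[p [pP wp]]|duv].
  have [q [r [wq wr pE]]] := walk_split pP.1 wp.
  apply/eqP; rewrite eqn_leq dist_triangle andbT -(dist_geodesic pP) pE size_cat.
  by rewrite leq_add ?dist_le_size.
have [q wq sq] := dist_walk u w; have [r wr sr] := dist_walk w v.
exists (q ++ r); split; last first.
  have := last_In u q; rewrite wq.2 => -[->|wIn]; first by left.
  by right; apply/List.in_or_app; left.
by apply: walk_geodesic; [exact: walk_cat wq wr | rewrite size_cat sq sr].
Qed.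

Lemma convexE (S : set M) : convex S <->
  forall x y w, S x -> S y -> interval x y w -> S w.
Proof.
split=> [cS x y w Sx Sy [p [pP wp]]|cS x y p Sx Sy pP w wp].
  exact: cS pP _ wp.
by apply: (cS x y) => //; exists p.
Qed.

End Distance.

(** * Half-spaces of a median graph *)

Section HalfSpaces.
Variable M : sgraph.
Hypothesis M_median : median_graph M.
Implicit Types (u v w x y z : M).

Let M_conn : connected M := M_median.1.
Let dC := distC M_conn.
Let dT := dist_triangle M_conn.

Definition halfspace u v : set M := [set w | dist w u < dist w v].

Lemma dist_median u v w : exists m,
  [/\ dist u m + dist m v = dist u v, dist v m + dist m w = dist v w &
      dist w m + dist m u = dist w u].
Proof.
have [m mP] := M_median.2 u v w; exists m.
have [[/intervalE ? /intervalE ?] /intervalE ?] :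
  (interval u v `&` interval v w `&` interval w u) m by rewrite mP.
by split; auto.
Qed.

Lemma dist_median_unique u v w m n :
  dist u m + dist m v = dist u v -> dist v m + dist m w = dist v w ->
  dist w m + dist m u = dist w u ->
  dist u n + dist n v = dist u v -> dist v n + dist n w = dist v w ->
  dist w n + dist n u = dist w u -> m = n.
Proof.
move=> *; have [k kP] := M_median.2 u v w.
suff [-> ->] : [set k] m /\ [set k] n by [].
by rewrite -kP; split; (split; [split|]); apply/intervalE.
Qed.

(** The median of [u], [v], [w] lies on the edge [uv], so it is [u] or [v], and that end is strictly
    nearer to [w]. *)
Lemma dist_neq u v w : adj u v -> dist w u <> dist w v.
Proof.
move=> uv; have [m [muv mvw mwu]] := dist_median u v w.
have := adj_dist M_conn uv; move: muv mvw mwu; rewrite !(dC w) (dC m w) (dC m u) (dC v m).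
by lia.
Qed.

Lemma halfspaceC u v w : adj u v -> halfspace v u w <-> ~ halfspace u v w.
Proof. by move=> uv; have := @dist_neq u v w uv; rewrite /halfspace /=; lia. Qed.

Lemma dist_adj_le w u v : adj u v -> dist w u <= (dist w v).+1.
Proof. by move=> uv; have := dT v w u; rewrite (dC v) (adj_dist M_conn uv) addn1. Qed.

Lemma halfspace_dist u v w : adj u v -> halfspace u v w -> dist w v = (dist w u).+1.
Proof.
by rewrite /halfspace /= => uv; have := @dist_adj_le w v u; rewrite adj_sym => /(_ uv); lia.
Qed.

(* Otherwise [u] and [v'] are at distance 2 with three common neighbours [v], [u'] and
   the median of [u], [v'], [w]; then [u] and [v'] are both medians of these three. *)
Lemma halfspace_square_sub u v u' v' : adj u v -> adj u' v' -> adj u u' -> adj v v' ->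
  dist u v' = 2 -> dist u' v = 2 -> halfspace u v `<=` halfspace u' v'.
Proof.
move=> uv u'v' uu' vv' duv' du'v w wuv; apply: contrapT => /(halfspaceC _ u'v') wvu.
have [m [m1 m2 m3]] := dist_median u v' w.
have v'u' : adj v' u' by rewrite adj_sym.
have E1 := halfspace_dist uv wuv; have E2 := halfspace_dist v'u' wvu.
have := @dist_adj_le w u' u; rewrite adj_sym uu' => /(_ isT) L1.
have := @dist_adj_le w v v' vv' => L2.
move: (adj_dist M_conn uv) (adj_dist M_conn u'v') (adj_dist M_conn uu')
  (adj_dist M_conn vv') => d1 d2 d3 d4.
have := @dT m v w; have := @dT m u' w; have := @dT u v m; have := @dT u u' m.
move: L1 L2 E1 E2 m1 m2 m3.
rewrite !(dC w) !(dC m u) !(dC v' m) !(dC v u) !(dC u' u).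
move=> L1 L2 E1 E2 m1 m2 m3 T1 T2 T3 T4.
have dmw : dist u m = 1 /\ dist m v' = 1 by lia.
have dvm : dist v m = 2 by lia.
have du'm : dist u' m = 2 by lia.
suff uv'E : u = v' by rewrite uv'E (distxx M_conn) in duv'.
have S1 := dC v u; have S2 := dC u u'; have S3 := dC u' v; have S4 := dC v m.
have S5 := dC m u'; have S6 := dC v v'; have S7 := dC v' u'; have S8 := dC m v'.
have S9 := dC m u.
by apply: (@dist_median_unique v u' m); lia.
Qed.

Lemma halfspace_square u v u' v' : adj u v -> adj u' v' -> adj u u' -> adj v v' ->
  dist u v' = 2 -> dist u' v = 2 -> halfspace u v = halfspace u' v'.
Proof.
move=> uv u'v' uu' vv' d1 d2; apply/seteqP; split; first exact: halfspace_square_sub.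
by apply: halfspace_square_sub; rewrite // adj_sym.
Qed.

(** Slide [uv] towards [xz] by induction on [dist u x]. If [u'] is the neighbour of [u] towards [x]
    and [v'] the median of [v], [u'], [z], then [u v v' u'] is a square, and [halfspace_square]
    replaces [uv] by [u'v']. *)
Lemma halfspace_parallel u v x z : adj u v -> adj x z -> halfspace u v x -> halfspace v u z ->
  halfspace u v = halfspace x z.
Proof.
move: {2}(dist u x) (erefl (dist u x)) => n; elim: n u v => [|n IH] u v dux uv xz xuv zvu.
  move: dux => /(dist_eq0 M_conn) ux; subst x.
  have vu : adj v u by rewrite adj_sym.
  have := halfspace_dist vu zvu; have := adj_dist M_conn xz; rewrite (dC z) => -> [].
  by rewrite (dC z) => /esym /(dist_eq0 M_conn) ->.
have vu : adj v u by rewrite adj_sym.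
have zx : adj z x by rewrite adj_sym.
have E1 := halfspace_dist uv xuv; have E2 := halfspace_dist vu zvu.
have [u' uu' dux'] : exists2 u', adj u u' & dist u x = (dist u' x).+1.
  by apply: (dist_step M_conn) => E; rewrite E (distxx M_conn) in dux.
have L1 := @dist_adj_le u x z xz; have L2 := @dist_adj_le v x z xz.
have L3 := @dist_adj_le u z x zx; have L4 := @dist_adj_le v z x zx.
have L5 := @dist_adj_le u' z x zx; have L6 := @dist_adj_le z u u' uu'.
have T1 := dT u' v x; have T2 := dT u u' v.
have [v' [m1 m2 m3]] := dist_median v u' z.
have d1 := adj_dist M_conn uv; have d2 := adj_dist M_conn uu'.
move: dux dux' E1 E2 L1 L2 L3 L4 L5 L6 T1 T2 m1 m2 m3.
rewrite ?(dC u x) ?(dC u' x) ?(dC v x) ?(dC u z) ?(dC u' z) ?(dC v z) ?(dC v' z).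
rewrite ?(dC v u) ?(dC u' u) ?(dC v u') ?(dC v' u') ?(dC v' v).
move=> dux dux' E1 E2 L1 L2 L3 L4 L5 L6 T1 T2 m1 m2 m3.
have du'v : dist u' v = 2 by lia.
have vv' : adj v v' by apply: (dist_eq1 M_conn); lia.
have u'v' : adj u' v' by apply: (dist_eq1 M_conn); lia.
have T3 := dT v' u z; have T4 := dT v u v'; have d3 := adj_dist M_conn vv'.
have S1 := dC v' z; have S2 := dC u z.
have duv' : dist u v' = 2 by lia.
rewrite (halfspace_square uv u'v' uu' vv' duv' du'v).
have d4 := adj_dist M_conn u'v'; have d5 := adj_dist M_conn xz.
have T5 := dT v' x v; have S4 := dC v' v.
by apply: IH; rewrite // /halfspace /= ?(dC u' x); lia.
Qed.

Lemma halfspace_l u v : adj u v -> halfspace u v u.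
Proof. by move=> uv; rewrite /halfspace /= (distxx M_conn) (adj_dist M_conn uv). Qed.

Lemma halfspace_r u v : adj u v -> halfspace v u v.
Proof. by move=> uv; apply: halfspace_l; rewrite adj_sym. Qed.

(** A geodesic from [x] to [y] cannot leave the half-space. If its step [xx'] did,
    [halfspace_parallel] would give [halfspace u v = halfspace x x'], but [y] is nearer to [x'] than
    to [x]. *)
Lemma halfspace_convex u v x y w : adj u v -> halfspace u v x -> halfspace u v y ->
  interval x y w -> halfspace u v w.
Proof.
move=> uv; move: {2}(dist x w) (erefl (dist x w)) => n.
elim: n x => [|n IH] x dxw xH yH /(intervalE M_conn) wI.
  by rewrite -(dist_eq0 M_conn dxw).
have [x' xx' dx'] : exists2 x', adj x x' & dist x w = (dist x' w).+1.
  by apply: (dist_step M_conn) => E; rewrite E (distxx M_conn) in dxw.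
have T1 := dT x' x y; have T2 := dT w x' y; have d1 := adj_dist M_conn xx'.
apply: (IH x') => //; [by lia| |by apply/intervalE => //; lia].
apply: contrapT => /(halfspaceC _ uv) x'H.
by move: yH; rewrite (halfspace_parallel uv xx' xH x'H) /halfspace /= !(dC y); lia.
Qed.

(** Let [p] be a vertex of [S] nearest to [x], and [y] the neighbour of [x] towards [p]. For [z] in
    [S], the median of [x], [p], [z] lies in [S] by convexity, hence is [p] by minimality. So [p],
    and with it [y], lies between [x] and [z]. *)
Lemma halfspace_separates_convex (S : set M) x : convex S -> S !=set0 -> ~ S x ->
  exists2 y, adj x y & S `<=` halfspace y x.
Proof.
move=> /convexE cS [s0 Ss0] Sx.
have ex : exists n, `[< exists2 s, S s & dist x s = n >].
  by exists (dist x s0); apply/asboolP; exists s0.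
case: (ex_minnP ex) => n /asboolP[p Sp dxp] nmin.
have [y xy dxy] : exists2 y, adj x y & dist x p = (dist y p).+1.
  by apply: (dist_step M_conn) => E; rewrite E in Sx.
exists y => // z Sz; have [m [m1 m2 m3]] := dist_median x p z.
have Sm : S m by apply: (cS p z) => //; apply/intervalE.
have : n <= dist x m by apply: nmin; apply/asboolP; exists m.
have T := dT p y z; move: m1 m2 m3; rewrite /halfspace /= !(dC z) (dC m x) (dC p m).
by lia.
Qed.

(** Distances to adjacent vertices differ by exactly one, so the strict inequality in [Theta] forces
    the ends of [f] onto opposite sides of [e], in the matching order. *)
Lemma thetaE (e f : M * M) : adj e.1 e.2 -> adj f.1 f.2 ->
  Theta e f <-> halfspace e.1 e.2 = halfspace f.1 f.2.
Proof.
case: e f => u v [x z] /= uv xz; split.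
  rewrite /Theta /= => th; have zx : adj z x by rewrite adj_sym.
  have N1 := @dist_neq u v x uv; have N2 := @dist_neq u v z uv.
  have L1 := @dist_adj_le u z x zx; have L2 := @dist_adj_le v x z xz.
  have vu : adj v u by rewrite adj_sym.
  have L3 := @dist_adj_le z u v uv; have L4 := @dist_adj_le x v u vu.
  by apply: halfspace_parallel => //; rewrite /halfspace /=;
    move: th L1 L2; rewrite !(dC _ x) !(dC _ z); lia.
move=> E; have Hx : halfspace u v x by rewrite E; apply: halfspace_l.
have : halfspace v u z.
  by apply/(halfspaceC _ uv); rewrite E => /(proj1 (halfspaceC z xz) (halfspace_r xz)).
by move: Hx; rewrite /halfspace /= /Theta /= !(dC x) !(dC z); lia.
Qed.

Lemma theta_class_refl (e : M * M) : adj e.1 e.2 -> theta_class e e.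
Proof. by move=> eP; split=> //; apply/thetaE. Qed.

Lemma halfspace_rev u v x z : adj u v -> adj x z -> halfspace u v = halfspace x z ->
  halfspace v u = halfspace z x.
Proof.
move=> uv xz E; apply/seteqP.
split=> w.
  by move=> /(halfspaceC _ uv) wH; apply/(halfspaceC _ xz); rewrite -E.
by move=> /(halfspaceC _ xz) wH; apply/(halfspaceC _ uv); rewrite E.
Qed.

Lemma pos_theta_class (e : M * M) : adj e.1 e.2 -> pos (theta_class e) = halfspace e.1 e.2.
Proof.
move=> eP; apply/seteqP; split=> [w [f [[fP /(thetaE eP fP) ->]]]|w wH] //.
by exists e; split=> //; exact: theta_class_refl.
Qed.

Lemma neg_theta_class (e : M * M) : adj e.1 e.2 -> neg (theta_class e) = halfspace e.2 e.1.
Proof.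
move=> eP; apply/seteqP; split=> [w [f [[fP /(thetaE eP fP) E]]]|w wH].
  by rewrite (halfspace_rev eP fP E).
by exists e; split=> //; exact: theta_class_refl.
Qed.

Lemma theta_class_halfspace (e f : M * M) : adj e.1 e.2 -> adj f.1 f.2 ->
  theta_class e = theta_class f -> halfspace e.1 e.2 = halfspace f.1 f.2.
Proof. by move=> eP fP E; rewrite -pos_theta_class// E pos_theta_class. Qed.

End HalfSpaces.

(** * Separations and ultrafilters *)

Section SeparationOrder.
Variable G : sgraph.
Implicit Types (s t r : separation G) (U Q : set (separation G)) (c : nat -> separation G).

Lemma flipK s : flip (flip s) = s. Proof. by case: s. Qed.

Lemma flip_inj s t : flip s = flip t -> s = t.
Proof. by move=> E; rewrite -(flipK s) E flipK. Qed.

Lemma sep_le_refl s : sep_le s s. Proof. by split. Qed.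

Lemma sep_le_trans t s r : sep_le s t -> sep_le t r -> sep_le s r.
Proof. by move=> [a b] [c d]; split=> x xP; [apply/c/a | apply/b/d]. Qed.

Lemma sep_le_anti s t : sep_le s t -> sep_le t s -> s = t.
Proof.
by case: s t => [a b] [c d] [/= ac db] [/= ca bd]; congr pair; apply/seteqP.
Qed.

Lemma sep_le_flip s t : sep_le (flip s) (flip t) <-> sep_le t s.
Proof. by split=> -[]. Qed.

Lemma sep_le_flipr s t : sep_le s (flip t) <-> sep_le t (flip s).
Proof. by rewrite -sep_le_flip flipK. Qed.

Lemma sep_le_flipl s t : sep_le (flip s) t <-> sep_le (flip t) s.
Proof. by rewrite -sep_le_flip flipK. Qed.

Lemma nestedP s t : nested s t <->
  sep_le s t \/ sep_le t s \/ sep_le s (flip t) \/ sep_le (flip t) s.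
Proof. by rewrite /nested /sep_comparable; tauto. Qed.

Lemma nested_sym s t : nested s t -> nested t s.
Proof. by rewrite !nestedP (sep_le_flipr s) (sep_le_flipl t); tauto. Qed.

Lemma nested_refl s : nested s s.
Proof. by left; left; exact: sep_le_refl. Qed.

Lemma chain_lt c m n : descending_chain c -> m < n -> sep_lt (c n) (c m).
Proof.
move=> cP; elim: n => // n IH; rewrite ltnS leq_eqVlt => /predU1P[->|/IH [le ne]].
  exact: cP.
have [le' ne'] := cP n; split; first exact: sep_le_trans le' le.
by move=> E; apply: ne'; apply: sep_le_anti => //; rewrite E.
Qed.

Lemma chain_inj c : descending_chain c -> injective c.
Proof.
move=> cP m n E; case: (ltngtP m n) => // /(chain_lt cP)[_]; rewrite E //.
Qed.

Lemma chain_infinite c : descending_chain c -> infinite_set (range c).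
Proof.
move=> /chain_inj c_inj; rewrite (eq_finite_set (B := [set: nat])).
  exact: infinite_nat.
by apply: inj_card_eq => m n _ _; exact: c_inj.
Qed.

Lemma DCC_min U Q : DCC U -> Q `<=` U -> Q !=set0 ->
  exists s, Q s /\ forall t, Q t -> sep_le t s -> t = s.
Proof.
move=> dccU QU [s0 Qs0]; apply: contrapT => nomin.
have next (s : {s | Q s}) : {t : {s | Q s} | sep_lt (sval t) (sval s)}.
  apply: cid; case: s => s Qs /=; apply: contrapT => nos.
  apply: nomin; exists s; split=> // t Qt ts; apply: contrapT => tns.
  by apply: nos; exists (exist _ t Qt).
have [f [_ fP]] := dependent_choice next (exist _ s0 Qs0).
by apply: dccU; exists (fun n => sval (f n)); split=> // n; apply/QU/svalP.
Qed.

End SeparationOrder.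

Section SeparationSystem.
Variables (G : sgraph) (Sigma : set (separation G)).
Hypothesis Sigma_sys : sep_system Sigma.
Implicit Types (s t r x y : separation G) (U V W D X : set (separation G)).

Lemma Sigma_flip s : Sigma s -> Sigma (flip s).
Proof. by case: Sigma_sys => _ _; apply. Qed.

Lemma not_le_flip s : Sigma s -> ~ sep_le s (flip s).
Proof.
case: Sigma_sys => seps ess _ Ss [/= s12 _]; have [_ +] := ess _ Ss; apply.
by have [<- _] := seps _ Ss; apply/seteqP; split=> [x|x []]; [right | apply: s12 |].
Qed.

Lemma not_flip_le s : Sigma s -> ~ sep_le (flip s) s.
Proof. by move=> /Sigma_flip/not_le_flip; rewrite flipK. Qed.

Lemma flip_neq s : Sigma s -> flip s <> s.
Proof. by move=> Ss E; apply: (not_flip_le Ss); rewrite E; exact: sep_le_refl. Qed.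

Lemma proper_side s : Sigma s -> exists v, s.1 v /\ ~ s.2 v.
Proof.
case: Sigma_sys => seps ess _ Ss; have [_ s2] := ess _ Ss.
have [cov _] := seps _ Ss; apply: contrapT => no; apply: s2.
apply/seteqP; split=> // v _; apply: contrapT => sv; apply: no.
exists v; split=> //; have [//|//] : (s.1 `|` s.2) v by rewrite cov.
Qed.

Section Ultrafilters.
Variable U : set (separation G).
Hypothesis U_uf : ultrafilter_on Sigma U.

Lemma uf_Sigma s : U s -> Sigma s.
Proof. by case: U_uf => + _ _; apply. Qed.

Lemma uf_flip s : Sigma s -> U (flip s) <-> ~ U s.
Proof. by case: U_uf => _ + _ => /[apply]; tauto. Qed.

Lemma uf_le s t : U s -> Sigma t -> sep_le s t -> U t.
Proof. by case: U_uf => _ _; apply. Qed.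

Lemma uf_not_le_flip s t : U s -> U t -> ~ sep_le s (flip t).
Proof.
move=> Us Ut st; have St := uf_Sigma Ut.
by have := uf_le Us (Sigma_flip St) st; rewrite uf_flip.
Qed.

End Ultrafilters.

Lemma uf_sub_eq U V : ultrafilter_on Sigma U -> ultrafilter_on Sigma V ->
  U `<=` V -> U = V.
Proof.
move=> ufU ufV UV; apply/seteqP; split=> // s Vs.
have Ss := uf_Sigma ufV Vs; apply: contrapT => /(uf_flip ufU Ss)/UV.
by move/(uf_flip ufV Ss).
Qed.

(** Minimality of [s] saves upward closure: if [flip s] is below [r] and [r] is not in [U], then
    [flip r] is a member of [U] below [s], so [r = flip s]. *)
Lemma flip_minimal U s : DCC_ultrafilter Sigma U -> U s ->
  (forall t, U t -> sep_le t s -> t = s) ->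
  DCC_ultrafilter Sigma (U `\ s `|` [set flip s]).
Proof.
move=> [ufU dccU] Us smin; have Ss := uf_Sigma ufU Us; split; last first.
  move=> [c [cU cdesc]]; apply: dccU; exists c; split=> // n.
  (* A term of the chain that follows a member of [U] downwards is irrelevant; what matters is that
     everything above a member of [U] is again in [U]. Hence [flip s] never occurs after the first
     term, since the next term would lie in [U] and lift it into [U]. *)
  have step m : c m.+1 <> flip s -> U (c m).
    move=> ne; have [le _] := cdesc m; have Um1 : U (c m.+1) by have [[]|] := cU m.+1.
    apply: uf_le Um1 _ le => //; have [[Um _]|/= ->] := cU m; first exact: uf_Sigma Um.
    exact: Sigma_flip.
  have [E|] := pselect (c n.+1 = flip s); last exact: step.
  have Un1 : U (c n.+1) by apply: step => E2; have [_] := cdesc n.+1; rewrite E E2.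
  by move: Un1; rewrite E (uf_flip ufU).
split.
- by move=> t [[/(uf_Sigma ufU)]|/= ->] //; exact: Sigma_flip.
- move=> t St; have := uf_flip ufU St; have := flip_neq Ss; have := flip_neq St.
  have [->|ts] := pselect (t = s).
    by move=> _ ne _; split; [right; right | move=> [[[_ /=]|/= /esym]]].
  have [->|tfs] := pselect (t = flip s).
    move=> _ ne _; rewrite flipK; split; first by left; right.
    by move=> [_ [[_ /=]|/= /esym]].
  have ftfs : flip t <> flip s by move=> /flip_inj.
  have fts : flip t <> s by move=> E; apply: tfs; rewrite -E flipK.
  move=> _ _ ff; split.
    have [Ut|/ff Uft] := pselect (U t); first by left; left.
    by right; left.
  by move=> [[[Ut _]|//] [[Uft _]|//]]; apply/ff: Ut.
- move=> t r [[Ut /= ts]|/= ->] Sr tr.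
    left; split; first exact: uf_le Ut Sr tr.
    by move=> /= E; apply: ts; apply: smin => //; rewrite -E.
  have [->|rfs] := pselect (r = flip s); first by right.
  left; split; last by move=> /= E; apply: (not_flip_le Ss); rewrite -{2}E.
  apply: contrapT => /(uf_flip ufU Sr) Ufr; apply: rfs.
  by rewrite -(flipK r) (smin (flip r))//; apply/sep_le_flipl.
Qed.

(** By upward closure a descending chain that leaves [U] or [V] never returns. Beyond some index it
    avoids both, hence all three pairwise intersections. *)
Lemma majority_uf U V W : DCC_ultrafilter Sigma U -> DCC_ultrafilter Sigma V ->
  DCC_ultrafilter Sigma W ->
  DCC_ultrafilter Sigma (U `&` V `|` V `&` W `|` W `&` U).
Proof.
move=> [ufU dccU] [ufV dccV] [ufW _]; split.
  split.
  - by move=> s [[[/(uf_Sigma ufU)]|[/(uf_Sigma ufV)]]|[/(uf_Sigma ufW)]].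
  - move=> s Ss; have := uf_flip ufU Ss; have := uf_flip ufV Ss.
    have := uf_flip ufW Ss; rewrite /setU /setI /=.
    by have [?|?] := pselect (U s); have [?|?] := pselect (V s);
      have [?|?] := pselect (W s); tauto.
  - move=> s t sP St st; have := @uf_le _ ufU s t; have := @uf_le _ ufV s t.
    by have := @uf_le _ ufW s t; move: sP; rewrite /setU /setI /=; tauto.
move=> [c [cU cdesc]].
have leave X : ultrafilter_on Sigma X -> DCC X -> exists n, forall m, n <= m -> ~ X (c m).
  move=> ufX dccX; apply: contrapT => no; apply: dccX; exists c; split=> // n.
  apply: contrapT => Xn; apply: no; exists n => m nm Xm; apply: Xn.
  apply: (uf_le ufX Xm).
    by have [[[]|[]]|[]] := cU n => [/(uf_Sigma ufU)|/(uf_Sigma ufV)|/(uf_Sigma ufW)].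
  move: nm; rewrite leq_eqVlt => /predU1P[->|nm]; first exact: sep_le_refl.
  by have [] := chain_lt cdesc nm.
have [n nU] := leave _ ufU dccU; have [m mV] := leave _ ufV dccV.
have Un := nU _ (leq_maxl n m); have Vm := mV _ (leq_maxr n m).
by have [[[]|[]]|[]] := cU (maxn n m).
Qed.

Hypothesis Sigma_cf : crossing_finite Sigma.

(** Zorn's lemma gives a maximal pairwise crossing family, and a member of [D] crossing all of it
    could be added. *)
Lemma maximal_crossing D : D `<=` Sigma -> exists X,
  [/\ X `<=` D, finite_set X,
      forall s t, X s -> X t -> nested s t -> s = t &
      forall t, D t -> exists2 s, X s & nested s t].
Proof.
move=> DS.
pose P X := X `<=` D /\ forall s t, X s -> X t -> nested s t -> s = t.
have [F FP Ftot|X [[XD Xcr] Xmax]] := @Zorn_bigcup _ P.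
  split=> [s [X /FP[XD _]]|s t [X FX Xs] [Y FY Yt]]; first exact: XD.
  have [XY|YX] := Ftot _ _ FX FY.
    by have [_] := FP _ FY; apply=> //; apply: XY.
  by have [_] := FP _ FX; apply=> //; apply: YX.
exists X; split=> //.
  apply: Sigma_cf => [s /XD/DS//|s t Xs Xt st nst].
  exact: st (Xcr _ _ Xs Xt nst).
move=> t Dt; apply: contrapT => no.
have tN s : X s -> ~ nested s t by move=> Xs nst; apply: no; exists s.
apply: (Xmax (X `|` [set t])).
  split; last by move=> /(_ t (or_intror erefl)) Xt; exact: tN Xt (nested_refl t).
  by move=> s; left.
split=> [s [/XD//|/= ->//]|s r [Xs|/= ->] [Xr|/= ->] nsr //].
- exact: Xcr.
- by case: (tN s).
- by case: (tN r) => //; apply: nested_sym.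
Qed.

Hypothesis Sigma_discrete : discrete_system Sigma.

(* Orient a maximal family [X] of pairwise crossing separations arbitrarily, and every
   other separation so that the members of [X] become minimal in the ultrafilter. *)
Lemma DCC_ultrafilter_exists : exists U, DCC_ultrafilter Sigma U.
Proof.
have [X [XS Xfin Xcr Xmax]] := maximal_crossing (@subset_refl _ Sigma).
pose U := [set s | Sigma s /\
  exists2 x, X x & sep_le x s \/ (sep_le (flip x) s /\ s <> flip x)].
exists U; split; last first.
  move=> [c [cU cdesc]].
  have : finite_set (range c).
    (* Each term lies between some [x] or [flip x], with [x] in [X], and [c 0]. These are finitely
       many intervals, each finite by discreteness. *)
    pose B := \bigcup_(x in X `|` [set flip x | x in X])
      [set t | Sigma t /\ sep_le x t /\ sep_le t (c 0)].
    have sub : range c `<=` B.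
      move=> _ [n _ <-]; have [Sn [x Xx xn]] := cU n.
      have n0 : sep_le (c n) (c 0).
        case: n {Sn xn} => [|n]; first exact: sep_le_refl.
        by have [] := chain_lt cdesc (ltn0Sn n).
      case: xn => [xn|[xn _]]; first by exists x; [left|].
      by exists (flip x); [right; exists x|].
    apply: (sub_finite_set sub).
    apply: bigcup_finite; first by rewrite finite_setU; split=> //; exact: finite_image.
    move=> x xX; apply: Sigma_discrete; last by have [] := cU 0.
    by case: xX => [/XS//|[y /XS Sy <-]]; exact: Sigma_flip.
  exact: chain_infinite.
split.
- by move=> s [].
- move=> s Ss; split.
    have [x Xx /nestedP xs] := Xmax _ Ss.
    have Sfs := Sigma_flip Ss.
    case: xs => [xs|[sx|[xfs|fsx]]].
    + by left; split=> //; exists x => //; left.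
    + have [E|ne] := pselect (s = x).
        by left; split=> //; exists x => //; left; rewrite E; exact: sep_le_refl.
      right; split=> //; exists x => //; right; split; first exact/sep_le_flip.
      by move=> /flip_inj.
    + by right; split=> //; exists x => //; left.
    + have [E|ne] := pselect (s = flip x).
        right; split=> //; exists x => //; left; rewrite E flipK; exact: sep_le_refl.
      by left; split=> //; exists x => //; right; split=> //; apply/sep_le_flipl.
  move=> [[_ [x Xx xs]] [_ [y Xy ys]]].
  have Sx := XS _ Xx.
  (* In every case [x] is comparable to [y] or [flip y], so [x = y]. This makes [x] comparable to
     its flip or violates the exclusion of [flip x] from [U]. *)
  case: xs ys => [xs|[xs sx]] [ys|[ys sy]].
  + have le : sep_le x (flip y) by apply: sep_le_trans xs _; apply/sep_le_flipr.
    have E : x = y by apply: Xcr => //; right; left.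
    by apply: (not_le_flip Sx); rewrite {2}E.
  + have sy' : sep_le s y by apply/sep_le_flip.
    have E : x = y by apply: Xcr => //; left; left; exact: sep_le_trans xs sy'.
    by apply: sy; congr flip; apply: sep_le_anti => //; rewrite -E.
  + have sy' : sep_le s (flip y) by apply/sep_le_flipr.
    have E : x = y.
      by apply: Xcr => //; left; right; apply/sep_le_flip; exact: sep_le_trans xs sy'.
    by apply: sx; apply: sep_le_anti => //; rewrite E.
  + have sy' : sep_le s y by apply/sep_le_flip.
    have le := sep_le_trans xs sy'.
    have E : x = y by apply: Xcr => //; right; right; apply/sep_le_flipl.
    by apply: (not_flip_le Sx); rewrite {2}E.
- move=> s t [Ss [x Xx xs]] St st; split=> //; exists x => //.
  case: xs => [xs|[xs sx]]; first by left; exact: sep_le_trans xs st.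
  right; split; first exact: sep_le_trans xs st.
  by move=> E; apply: sx; apply: sep_le_anti => //; rewrite -E.
Qed.

End SeparationSystem.

(** * Sides of a decomposition *)

Section Sides.
Variables (G N : sgraph) (alpha : N -> set G) (Sigma : set (separation G)).
Hypothesis alpha_md : median_decomposition alpha.
Hypothesis alpha_reduced : reduced alpha.
Hypothesis alpha_Sigma : induced_seps alpha = Sigma.
Hypothesis Sigma_sys : sep_system Sigma.
Implicit Types (s t r : separation G) (u v w x y z : N) (U : set (separation G)).

Let N_median : median_graph N.
Proof. by case: alpha_md. Qed.

Let N_conn : connected N := N_median.1.

Definition edge_sep u v : separation G :=
  (\bigcup_(w in halfspace u v) alpha w, \bigcup_(w in halfspace v u) alpha w).

Lemma induced_sepE u v : adj u v -> induced_sep alpha (theta_class (u, v)) = edge_sep u v.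
Proof.
by move=> uv; rewrite /induced_sep (@pos_theta_class _ _ (u, v))// (@neg_theta_class _ _ (u, v)).
Qed.

Lemma SigmaP s : Sigma s <-> exists u v, adj u v /\ s = edge_sep u v.
Proof.
rewrite -alpha_Sigma; split=> [[_ [[u v] /= uv <-] <-]|[u [v [uv ->]]]].
  by exists u, v; split=> //; exact: induced_sepE.
by exists (theta_class (u, v)); [exists (u, v) | exact: induced_sepE].
Qed.

(** Reducedness makes the half-space a function of the separation, so that [side] is well
    defined. *)
Lemma edge_sep_inj u v x y : adj u v -> adj x y -> edge_sep u v = edge_sep x y ->
  halfspace u v = halfspace x y.
Proof.
move=> uv xy; rewrite -!induced_sepE // => E.
apply: (@theta_class_halfspace _ N_median (u, v) (x, y)) => //.
by apply: alpha_reduced.2 E; [exists (u, v) | exists (x, y)].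
Qed.

(* [side s x] says that [x] lies in the half-space of [N] inducing [s]. *)
Definition side s : set N := [set x | exists u v, [/\ adj u v, s = edge_sep u v & halfspace u v x]].

Lemma side_edge_sep u v : adj u v -> side (edge_sep u v) = halfspace u v.
Proof.
move=> uv; apply/seteqP; split=> x; last by move=> xH; exists u, v.
by move=> [a [b [ab /(edge_sep_inj uv ab) -> ]]].
Qed.

Lemma side_flip s x : Sigma s -> side (flip s) x <-> ~ side s x.
Proof.
move=> /SigmaP[u [v [uv ->]]].
rewrite (_ : flip _ = edge_sep v u)// !side_edge_sep// 1?adj_sym//.
exact: halfspaceC.
Qed.

Lemma side_fst s g : Sigma s -> s.1 g <-> exists2 x, side s x & alpha x g.
Proof. by move=> /SigmaP[u [v [uv ->]]]; rewrite side_edge_sep. Qed.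

Lemma side_snd s g : Sigma s -> s.2 g <-> exists2 x, ~ side s x & alpha x g.
Proof.
move=> Ss; have fst' := @side_fst (flip s) g (Sigma_flip Sigma_sys Ss).
split=> [/fst'[x /(side_flip _ Ss)]|[x xs xg]]; first by exists x.
by apply/fst'; exists x => //; apply/side_flip.
Qed.

Lemma side_le s t : Sigma s -> Sigma t -> side s `<=` side t -> sep_le s t.
Proof.
move=> Ss St st; split=> g.
  by rewrite !side_fst// => -[x /st]; exists x.
by rewrite !side_snd// => -[x xt]; exists x => // /st.
Qed.

Lemma side_convex s : Sigma s -> convex (side s).
Proof.
move=> /SigmaP[u [v [uv ->]]]; rewrite side_edge_sep//; apply/convexE => x y w.
exact: halfspace_convex.
Qed.

Lemma side_interval s x y w : Sigma s -> side s x -> side s y -> interval x y w -> side s w.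
Proof. by move=> /side_convex/convexE; apply. Qed.

Lemma edge_sep_Sigma u v : adj u v -> Sigma (edge_sep u v).
Proof. by move=> uv; apply/SigmaP; exists u, v. Qed.

Lemma side_nonempty s : Sigma s -> side s !=set0.
Proof.
move=> /SigmaP[u [v [uv ->]]]; exists u; rewrite side_edge_sep//; exact: halfspace_l.
Qed.

Lemma separator_edge s x y : Sigma s -> adj x y -> side s x -> ~ side s y ->
  s = edge_sep x y.
Proof.
move=> /SigmaP[u [v [uv ->]]] xy; rewrite side_edge_sep// => xH /(halfspaceC N_median _ uv) yH.
have E := halfspace_parallel N_median uv xy xH yH.
by rewrite /edge_sep E (halfspace_rev N_median uv xy E).
Qed.

(** By [separator_edge], each step of a geodesic from [x] to [y] accounts for a single separator. *)
Lemma finite_separators x y : finite_set [set s | Sigma s /\ side s x /\ ~ side s y].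
Proof.
move: {2}(dist x y) (erefl (dist x y)) => n; elim: n x => [|n IH] x dxy.
  apply: (@sub_finite_set _ _ set0) => [s [_]|]; last exact: finite_set0.
  by rewrite (dist_eq0 N_conn dxy) => -[].
have [z xz dz] : exists2 z, adj x z & dist x y = (dist z y).+1.
  by apply: (dist_step N_conn) => E; rewrite E (distxx N_conn) in dxy.
have zn : dist z y = n by lia.
apply: (@sub_finite_set _ _ ([set edge_sep x z] `|` [set s | Sigma s /\ side s z /\ ~ side s y])).
  move=> s [Ss [sx sy]]; have [sz|sz] := pselect (side s z); first by right.
  by left; apply: separator_edge.
by rewrite finite_setU; split; [exact: finite_set1 | exact: IH].
Qed.

Lemma separating_side x y : x <> y -> exists z, adj x z /\ halfspace z x y.
Proof.
move=> /(dist_step N_conn)[z xz dxy]; exists z; split=> //.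
by rewrite /halfspace /= (distC N_conn y z) (distC N_conn y x) dxy.
Qed.

Lemma side_inj x y : (forall s, Sigma s -> side s x -> side s y) -> x = y.
Proof.
move=> xy; apply: contrapT => /separating_side[z [xz /halfspaceC yz]].
have := xy _ (edge_sep_Sigma xz); rewrite side_edge_sep// => /(_ (halfspace_l N_median xz)).
exact: yz.
Qed.

(** For the converse, let [m] be the median of [x], [y], [w]. If [w] is not [m], the edge from [w]
    towards [m] defines a half-space containing [x] and [y] but not [w]. *)
Lemma interval_sides x y w :
  interval x y w <-> forall s, Sigma s -> side s x -> side s y -> side s w.
Proof.
split=> [xyw s Ss sx sy|xyw]; first exact: side_interval xyw.
have [m [m1 m2 m3]] := dist_median N_median x y w.
suff -> : w = m by apply/intervalE.
apply: contrapT => /(dist_step N_conn)[z wz dwm].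
have zw : adj z w by rewrite adj_sym.
have := xyw _ (edge_sep_Sigma zw); rewrite side_edge_sep// => H.
suff /(halfspaceC N_median _ wz) : halfspace z w w by apply; exact: halfspace_l.
have dC := distC N_conn.
have T1 := dist_triangle N_conn m x z; have T2 := dist_triangle N_conn m y z.
by apply: H; rewrite /halfspace /=; move: m1 m2 m3 T1 T2 dwm;
  rewrite !(dC w) !(dC z) ?(dC m x); lia.
Qed.

(** If [x] is outside the convex fibre of [g], some edge [xy] has the whole fibre on the side of
    [y], so no bag on the side of [x] contains [g]. *)
Lemma bagE x g : alpha x g <-> forall s, Sigma s -> side s x -> s.1 g.
Proof.
split=> [xg s Ss sx|xg]; first by apply/side_fst => //; exists x.
case: alpha_md => _ cov _ fib.
have fib0 : [set u | alpha u g] !=set0.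
  by have : setT g by []; rewrite -cov => -[u _ ug]; exists u.
apply: contrapT => xNg.
have [y xy sub] := halfspace_separates_convex N_median (fib g) fib0 xNg.
have sx : side (edge_sep x y) x by rewrite side_edge_sep//; exact: halfspace_l.
have [u uH ug] := xg _ (edge_sep_Sigma xy) sx.
by have /(halfspaceC N_median _ xy) := sub _ ug; apply.
Qed.

(** Choose [g] in [s.1] outside [s.2]. Every [t] above [s] also has [g] outside [t.2], so all bags
    containing [g] lie in [side t]. *)
Lemma common_upper_vertex s : Sigma s ->
  exists y, forall t, Sigma t -> sep_le s t -> side t y.
Proof.
move=> Ss; have [g [g1 g2]] := proper_side Sigma_sys Ss.
have [y sy yg] := (side_fst g Ss).1 g1; exists y => t St [_ ts].
by apply: contrapT => ty; apply/g2/ts/side_snd => //; exists y.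
Qed.

(** * The vertex determined by a DCC ultrafilter *)

Hypothesis Sigma_cf : crossing_finite Sigma.

(** Every [t] in [D] is nested with a member [s] of a finite crossing family. The [t] above [s] or
    [flip s] share a vertex by [common_upper_vertex] and miss [x], so they are finitely many, and
    [s <= flip t] is excluded. Only the cones below can be infinite. *)
Lemma infinite_lower D x : D `<=` Sigma -> infinite_set D ->
  (forall s, D s -> ~ side s x) -> (forall s t, D s -> D t -> ~ sep_le s (flip t)) ->
  exists2 s, D s & infinite_set [set t | D t /\ sep_le t s].
Proof.
move=> DS Dinf Dx Dcons; apply: contrapT => no; apply: Dinf.
have [X [XD Xfin _ Xmax]] := maximal_crossing Sigma_cf DS.
have up s : Sigma s -> finite_set [set t | D t /\ sep_le s t].
  move=> /common_upper_vertex[y yP]; apply: sub_finite_set (finite_separators y x).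
  by move=> t [Dt st]; split; [exact: DS | split; [apply: yP => //; exact: DS | exact: Dx]].
pose F s := [set t | D t /\ sep_le t s] `|`
  ([set t | D t /\ sep_le s t] `|` [set t | D t /\ sep_le (flip s) t]).
have sub : D `<=` \bigcup_(s in X) F s.
  move=> t Dt; have [s Xs /nestedP nst] := Xmax _ Dt; exists s => //.
  case: nst => [st|[ts|[|fts]]].
  - by right; left.
  - by left.
  - by move/Dcons => /(_ (XD _ Xs) Dt).
  - by right; right; split=> //; apply/sep_le_flipl.
apply: (sub_finite_set sub); apply: bigcup_finite => // s /XD Ds.
rewrite /F !finite_setU; split; last first.
  by split; apply: up; [exact: DS | apply: Sigma_flip => //; exact: DS].
by apply: contrapT => inf; apply: no; exists s.
Qed.

Lemma finite_misoriented U x : DCC_ultrafilter Sigma U ->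
  finite_set [set s | U s /\ ~ side s x].
Proof.
move=> [ufU dccU]; set D := [set s | _]; apply: contrapT => Dinf.
have low E : E `<=` D -> infinite_set E ->
    exists2 s, E s & infinite_set [set t | E t /\ sep_le t s].
  move=> ED Einf; apply: (infinite_lower (x := x)) => //.
  - by move=> s /ED[/(uf_Sigma ufU)].
  - by move=> s /ED[].
  - move=> s t /ED[Us _] /ED[Ut _]; exact: (uf_not_le_flip Sigma_sys ufU Us Ut).
have [s0 Ds0 s0inf] := low D (@subset_refl _ D) Dinf.
have [||s [[Ds sinf] smin]] :=
  @DCC_min _ U [set s | D s /\ infinite_set [set t | D t /\ sep_le t s]] dccU.
- by move=> s [[]].
- by exists s0.
(* Removing [s] from its own lower cone forces a strictly smaller element with an infinite lower
   cone, against the minimality of [s]. *)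
have [t [[Dt ts] tns] tinf] : exists2 t, ([set t | D t /\ sep_le t s] `\ s) t &
    infinite_set [set r | ([set t | D t /\ sep_le t s] `\ s) r /\ sep_le r t].
  apply: low; first by move=> r [[]].
  by apply: infinite_setD => //; exact: finite_set1.
apply: tns; apply: smin => //; split=> //.
by apply: sub_infinite_set tinf => r [[[Dr _] _] rt].
Qed.

Lemma uf_vertex U : DCC_ultrafilter Sigma U ->
  exists x, forall s, Sigma s -> U s <-> side s x.
Proof.
move=> ufU; have [[x0 _] _] := N_conn.
pose D x := [set s | U s /\ ~ side s x].
have ex : exists n, `[< exists x, #|` fset_set (D x)|%fset = n >].
  by exists #|` fset_set (D x0)|%fset; apply/asboolP; exists x0.
case: (ex_minnP ex) => n /asboolP[x xn] nmin.
exists x => s Ss; have [ufU' dccU] := ufU.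
have sub t : U t -> side t x; last first.
  split; first exact: sub.
  by move=> sx; apply: contrapT => /(uf_flip ufU' Ss)/sub/(side_flip _ Ss).
move=> {s Ss} Ut; apply: contrapT => tx.
have St := uf_Sigma ufU' Ut.
have [y xy sub] := halfspace_separates_convex N_median (side_convex St) (side_nonempty St) tx.
have yx : adj y x by rewrite adj_sym.
pose e := edge_sep y x.
have Se : Sigma e by exact: edge_sep_Sigma.
have Ue : U e by apply: (uf_le ufU' Ut) => //; apply: side_le; rewrite // side_edge_sep.
have ey : side e y by rewrite side_edge_sep//; exact: halfspace_l.
have ex' : ~ side e x.
  by rewrite side_edge_sep// => /(halfspaceC N_median _ xy); apply; exact: halfspace_l.
(* Only [e] and [flip e] separate [x] from [y], and [U] contains [e] alone of these two. *)
have DyE : D y = D x `\ e.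
  apply/seteqP; split=> [r [Ur ry]|r [[Ur rx] /= re]]; last first.
    by split=> // ry; apply: re; apply: separator_edge => //; exact: (uf_Sigma ufU' Ur).
  split; last by move=> /= re; apply: ry; rewrite re.
  split=> // rx; have Sr := uf_Sigma ufU' Ur.
  have fre : flip r = e.
    apply: separator_edge => //; [exact: Sigma_flip | exact/side_flip |].
    by move=> /(side_flip _ Sr).
  by move: Ue; rewrite -fre (uf_flip ufU').
(* The count is genuine only for finite sets, as [fset_set] is empty on infinite ones. *)
have fin : finite_set (D x) by exact: finite_misoriented.
have := nmin #|` fset_set (D y)|%fset (introT (asboolP _) (ex_intro _ y erefl)).
rewrite -xn (cardfsD1 e (fset_set (D x))) -fset_setD1// -DyE in_fset_set// mem_set//.
by rewrite add1n ltnn.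
Qed.

End Sides.

(** * The embedding of the dual graph *)

Lemma card_set_2 (T : Type) (A : set T) : (A #= `I_2)%card ->
  exists a b, forall x, A x -> x = a \/ x = b.
Proof.
move=> /eq_cardSP[a Aa /eq_cardSP[b Ab]]; rewrite II0 card_eq0 => /eqP A0.
exists a, b => x Ax; apply: contrapT => /not_orP[xa xb].
by have : (A `\ a `\ b) x by []; rewrite A0.
Qed.

Section DualEmbedding.
Variables (G N : sgraph) (alpha : N -> set G) (Sigma : set (separation G)).
Hypothesis alpha_md : median_decomposition alpha.
Hypothesis alpha_reduced : reduced alpha.
Hypothesis alpha_Sigma : induced_seps alpha = Sigma.
Hypothesis Sigma_sys : sep_system Sigma.
Hypothesis Sigma_cf : crossing_finite Sigma.
Hypothesis Sigma_discrete : discrete_system Sigma.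

Local Notation M := (dual_graph Sigma).
Implicit Types (s t r : separation G) (x y z : N) (U V W X : M).

Let N_median : median_graph N.
Proof. by case: alpha_md. Qed.

Let N_conn : connected N := N_median.1.

Local Notation side := (side alpha).
Let sideF s x (Ss : Sigma s) : side (flip s) x <-> ~ side s x :=
  side_flip alpha_md alpha_reduced alpha_Sigma x Ss.
Let sideL s t : Sigma s -> Sigma t -> side s `<=` side t -> sep_le s t :=
  @side_le _ _ _ _ alpha_md alpha_reduced alpha_Sigma Sigma_sys s t.
Let edge_side u v (uv : adj u v) : side (edge_sep alpha u v) = halfspace u v :=
  side_edge_sep alpha_md alpha_reduced uv.
Let edge_Sigma u v (uv : adj u v) : Sigma (edge_sep alpha u v) :=
  edge_sep_Sigma alpha_md alpha_Sigma uv.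

Let dual_uf U : ultrafilter_on Sigma (sval U) := (svalP U).1.

Definition dual_embedding U : N :=
  projT1 (cid (uf_vertex alpha_md alpha_reduced alpha_Sigma Sigma_sys Sigma_cf (svalP U))).

Local Notation phi := dual_embedding.

Lemma dual_embeddingP U s : Sigma s -> sval U s <-> side s (phi U).
Proof. by rewrite /dual_embedding; case: cid => x /= xP; apply: xP. Qed.

Lemma dual_vert_inj U V : sval U = sval V -> U = V.
Proof.
by case: U V => U Uuf [V Vuf] /= E; subst V; congr exist; exact: Prop_irrelevance.
Qed.

Lemma dual_sub_eq U V : sval U `<=` sval V -> U = V.
Proof. by move=> UV; apply: dual_vert_inj; exact: (uf_sub_eq (dual_uf U) (dual_uf V)). Qed.

Lemma dual_embedding_inj : injective phi.
Proof.
move=> U V E; apply: dual_sub_eq => s Us; have Ss := uf_Sigma (dual_uf U) Us.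
by apply/dual_embeddingP => //; rewrite -E; apply/dual_embeddingP.
Qed.

(** If a geodesic from [x] to [y] began with two edges [xz] and [zw], both would give separators of
    [x] and [y]. Being equal, these would have the same side, but [z] lies in only one of the two
    half-spaces. *)
Lemma unique_separator_adj x y : x <> y ->
  (forall s t, Sigma s -> Sigma t -> side s x -> ~ side s y -> side t x -> ~ side t y -> s = t) ->
  adj x y.
Proof.
move=> /(dist_step N_conn)[z xz dxy] uniq.
have [<- //|zy] := pselect (z = y).
have [w zw dzy] := dist_step N_conn zy.
have xw : dist x w = 2.
  have := dist_triangle N_conn w x y; have := dist_triangle N_conn z x w.
  by rewrite (adj_dist N_conn xz) (adj_dist N_conn zw); lia.
have E : edge_sep alpha x z = edge_sep alpha z w.
  have dC := distC N_conn.
  apply: uniq; rewrite ?edge_side//; try exact: edge_Sigma.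
  - exact: halfspace_l.
  - by rewrite /halfspace /= !(dC y); lia.
  - by rewrite /halfspace /= xw (adj_dist N_conn xz).
  - by rewrite /halfspace /= !(dC y); lia.
have : side (edge_sep alpha z w) z by rewrite edge_side//; exact: halfspace_l.
rewrite -E edge_side//.
have zx : adj z x by rewrite adj_sym.
by move=> /(halfspaceC N_median _ zx) []; exact: halfspace_l.
Qed.

(** A separator [s] of the images puts [s] in [U] only and [flip s] in [V] only. This exhausts the
    two-element symmetric difference. *)
Lemma dual_embedding_adj U V : adj U V -> adj (phi U) (phi V).
Proof.
move=> UV; apply: unique_separator_adj.
  by move=> /dual_embedding_inj E; move: UV; rewrite E adj_irr.
move=> s t Ss St; rewrite -!dual_embeddingP// => Us Vs Ut Vt.
have [a [b ab]] := card_set_2 UV.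
have Vfs : sval V (flip s) by apply/(uf_flip (dual_uf V) Ss).
have Ufs : ~ sval U (flip s) by rewrite (uf_flip (dual_uf U) Ss).
have sa := ab s (or_introl (conj Us Vs)).
have ta := ab t (or_introl (conj Ut Vt)).
have fa := ab (flip s) (or_intror (conj Vfs Ufs)).
have nsf : flip s <> s := flip_neq Sigma_sys Ss.
have ntf : flip s <> t by move=> E; apply: Ufs; rewrite E.
by case: sa ta fa => [?|?] [?|?] [?|?]; congruence.
Qed.

(** A minimal [s] of [U] outside [V] is minimal in all of [U], since a member of [V] below [s] would
    put [s] in [V]. So [s] can be flipped. *)
Lemma dual_step U V : U <> V -> exists2 W, adj U W & sval U `&` sval V `<=` sval W.
Proof.
move=> UV.
have [||s [[Us Vs] smin]] := @DCC_min _ (sval U) (sval U `\` sval V) (svalP U).2.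
- by move=> s [].
- apply: contrapT => no; apply: UV; apply: dual_sub_eq => s Us.
  by apply: contrapT => Vs; apply: no; exists s.
have Ss := uf_Sigma (dual_uf U) Us.
have nfs := flip_neq Sigma_sys Ss.
have Ufs : ~ sval U (flip s) by rewrite (uf_flip (dual_uf U) Ss).
have minU t : sval U t -> sep_le t s -> t = s.
  by move=> Ut ts; apply: smin => //; split=> // Vt; apply: Vs; apply: (uf_le (dual_uf V) Vt).
exists (exist _ _ (flip_minimal Sigma_sys (svalP U) Us minU) : M); last first.
  by move=> t [Ut Vt]; left; split=> // ts; apply: Vs; rewrite -ts.
rewrite /adj /= /dual_adj /=; apply/eq_cardSP; exists s.
  left; split=> //.
  by move=> [[_ /=]|/= /esym].
rewrite (_ : _ `\ s = [set flip s]); first exact: card_set1.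
apply/seteqP; split=> [t [[[Ut Ht]|[[[Ut _]|//] Ht]] /= ts]|t /= ->].
- by case: Ht; left.
- by case: Ht.
- by split=> //; right; split=> //; right.
Qed.

(** The inclusion in [dual_step] puts [phi W] between [phi U] and [phi V], so each flip shortens the
    distance by one. This gives connectedness and one half of the isometry. *)
Lemma dual_walk U V : exists2 p, walk U V p & size p = dist (phi U) (phi V).
Proof.
move: {2}(dist _ _) (erefl (dist (phi U) (phi V))) => n; elim: n U => [|n IH] U dUV.
  by exists [::]; rewrite ?dUV//; split=> //; apply/dual_embedding_inj/(dist_eq0 N_conn).
have UV : U <> V by move=> E; rewrite E (distxx N_conn) in dUV.
have [W UW UVW] := dual_step UV.
have /(intervalE N_conn) : interval (phi U) (phi V) (phi W).
  apply/(interval_sides alpha_md alpha_reduced alpha_Sigma) => s Ss.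
  by rewrite -!dual_embeddingP// => Us Vs; apply: UVW.
rewrite dUV (adj_dist N_conn (dual_embedding_adj UW)) add1n => -[dWV].
have [p [pp lp] szp] := IH _ dWV.
by exists (W :: p); [split; [exact: (introT andP (conj UW pp)) |] | rewrite /= szp dWV].
Qed.

Lemma dual_connected : connected M.
Proof.
split=> [|U V]; last by have [p pP _] := dual_walk U V; exists p.
have [U Uuf] := DCC_ultrafilter_exists Sigma_sys Sigma_cf Sigma_discrete.
by exists (exist _ U Uuf).
Qed.

Lemma dual_dist U V : dist U V = dist (phi U) (phi V).
Proof.
apply/eqP; rewrite eqn_leq; apply/andP; split.
  by have [p pP <-] := dual_walk U V; exact: dist_le_size dual_connected _ _ _ pP.
have [p [pp lp] <-] := dist_walk dual_connected U V.
rewrite -(size_map phi); apply: dist_le_size => //; split; last by rewrite last_map lp.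
exact: (homo_path dual_embedding_adj pp).
Qed.

Lemma dual_interval U V W : interval U V W <-> interval (phi U) (phi V) (phi W).
Proof.
by rewrite (intervalE dual_connected) (intervalE N_conn) !dual_dist.
Qed.

Lemma dual_intervalP U V W : interval U V W <-> sval U `&` sval V `<=` sval W.
Proof.
rewrite dual_interval (interval_sides alpha_md alpha_reduced alpha_Sigma).
split=> [H s [Us Vs]|H s Ss].
  have Ss := uf_Sigma (dual_uf U) Us; apply/dual_embeddingP => //.
  by apply: H => //; apply/dual_embeddingP.
by rewrite -!dual_embeddingP// => Us Vs; apply: H.
Qed.

(** A vertex in all three intervals contains the majority ultrafilter, and hence equals it. *)
Lemma dual_median : median_graph M.
Proof.
split=> [|U V W]; first exact: dual_connected.
exists (exist _ _ (majority_uf (svalP U) (svalP V) (svalP W)) : M).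
apply/seteqP; split=> [X [[/dual_intervalP UV /dual_intervalP VW] /dual_intervalP WU]|X /= ->].
  by apply/esym/dual_sub_eq => s /= [[/UV|/VW]|/WU].
by split; [split|]; apply/dual_intervalP => s sP; [left; left | left; right | right].
Qed.

Lemma dual_embedding_median U V W X :
  is_median U V W X -> is_median (phi U) (phi V) (phi W) (phi X).
Proof.
move=> med; have [k kP] := N_median.2 (phi U) (phi V) (phi W).
have [[UV VW] WU] : (interval U V `&` interval V W `&` interval W U) X by rewrite med.
suff : [set k] (phi X) by rewrite /is_median kP => /= ->.
by rewrite -kP; split; [split|]; apply/dual_interval.
Qed.

Lemma dual_embedding_bag U : alpha (phi U) = dual_bag U.
Proof.
apply/seteqP; split=> g.
  move=> /(bagE alpha_md alpha_reduced alpha_Sigma) H s Us.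
  have Ss := uf_Sigma (dual_uf U) Us.
  by apply: H => //; apply/dual_embeddingP.
move=> H; apply/(bagE alpha_md alpha_reduced alpha_Sigma) => s Ss sU; apply: H.
exact/dual_embeddingP.
Qed.

(** * Crossing-faithfulness and surjectivity *)

Definition sides_cross s t :=
  [/\ side s `&` side t !=set0, side s `\` side t !=set0,
      side t `\` side s !=set0 & ~` (side s `|` side t) !=set0].

Lemma theta_cross_sides u v x y : adj u v -> adj x y ->
  theta_cross (theta_class (u, v)) (theta_class (x, y)) <->
  sides_cross (edge_sep alpha u v) (edge_sep alpha x y).
Proof.
move=> uv xy; rewrite /theta_cross /sides_cross !edge_side//.
rewrite (@pos_theta_class _ N_median (u, v))// (@neg_theta_class _ N_median (u, v))//.
rewrite (@pos_theta_class _ N_median (x, y))// (@neg_theta_class _ N_median (x, y))//=.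
have C (a b : N) : adj a b -> halfspace b a = ~` halfspace a b.
  by move=> ab; apply/seteqP; split=> z /(halfspaceC N_median _ ab).
by rewrite (C _ _ uv) (C _ _ xy) setCU !setDE (setIC (halfspace x y) (~` _)).
Qed.

Lemma crossing_faithfulP : crossing_faithful alpha <->
  forall s t, Sigma s -> Sigma t -> sides_cross s t -> sep_cross s t.
Proof.
split=> [cf s t|cf _ _ [[u v] /= uv <-] [[x y] /= xy <-]].
  move=> /(SigmaP alpha_md alpha_Sigma)[u [v [uv ->]]].
  move=> /(SigmaP alpha_md alpha_Sigma)[x [y [xy ->]]].
  move=> /(theta_cross_sides uv xy) /cf.
  by rewrite !(induced_sepE alpha_md)//; apply; [exists (u, v) | exists (x, y)].
rewrite (theta_cross_sides uv xy) !(induced_sepE alpha_md)//.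
by apply: cf; exact: edge_Sigma.
Qed.

(** A vertex in [side s] but not in [side t] would make the sides cross: if another quadrant were
    empty, [side_le] would give a relation that, with [s <= t], yields [s = t] or puts [s] or
    [flip t] below its own flip. *)
Lemma crossing_faithful_side_le : crossing_faithful alpha -> forall s t,
  Sigma s -> Sigma t -> sep_le s t -> side s `<=` side t.
Proof.
move=> /crossing_faithfulP cf s t Ss St st z sz; apply: contrapT => tz.
have Sfs := Sigma_flip Sigma_sys Ss; have Sft := Sigma_flip Sigma_sys St.
apply: (cf s t Ss St); last by left; left.
split.
- apply: contrapT => no; apply: (not_le_flip Sigma_sys Ss); apply: sep_le_trans st _.
  apply/sep_le_flipr/sideL => // w sw; apply/sideF => // tw.
  by apply: no; exists w.
- by exists z.
- apply: contrapT => no; have ts : sep_le t s.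
    by apply: sideL => // w tw; apply: contrapT => sw; apply: no; exists w.
  by apply: tz; rewrite (sep_le_anti ts st).
- apply: contrapT => no; apply: (not_flip_le Sigma_sys St).
  apply: sep_le_trans (_ : sep_le (flip s) t); first exact/sep_le_flip.
  apply: sideL => // w /(sideF _ Ss) sw; apply: contrapT => tw.
  by apply: no; exists w => -[].
Qed.

Lemma crossing_faithful_uf x : crossing_faithful alpha ->
  DCC_ultrafilter Sigma [set s | Sigma s /\ side s x].
Proof.
move=> cf; split.
  split=> [s []//|s Ss|s t [Ss sx] St st]; last first.
    by split=> //; exact: crossing_faithful_side_le st _ sx.
  have Sfs := Sigma_flip Sigma_sys Ss; have := sideF x Ss.
  by have [?|?] := pselect (side s x) => /= ?; tauto.
move=> [c [cU cdesc]].
(* The sides of the chain are nested, so a vertex [y] outside the first is outside all of them.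
   Every term then separates [x] from [y]. *)
have [y fy] := side_nonempty alpha_md alpha_reduced alpha_Sigma
  (Sigma_flip Sigma_sys (cU 0).1).
have : finite_set (range c).
  apply: (sub_finite_set _ (finite_separators alpha_md alpha_reduced alpha_Sigma x y)).
  move=> _ [n _ <-]; have [Sn cx] := cU n; split=> //; split=> // cy.
  have /sideF := fy => /(_ (cU 0).1); apply.
  case: n Sn cx cy => // n Sn _ cy.
  have [le _] := chain_lt cdesc (ltn0Sn n).
  exact: (crossing_faithful_side_le cf Sn (cU 0).1 le cy).
exact: chain_infinite.
Qed.

Lemma dual_embedding_surj :
  (forall x, exists U, phi U = x) <-> crossing_faithful alpha.
Proof.
split=> [surj|cf x]; last first.
  exists (exist _ _ (crossing_faithful_uf x cf) : M).
  apply: (side_inj alpha_md alpha_reduced alpha_Sigma) => s Ss.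
  by move=> /(dual_embeddingP _ Ss)[].
apply/crossing_faithfulP => s t Ss St [[x [sx tx]] [y [sy ty]] [z [tz sz]] [w /not_orP[sw tw]]].
(* When every vertex comes from an ultrafilter, upward closure turns [a <= b] into an inclusion of
   sides. Each way of being nested then empties one of the four quadrants. *)
have mono a b v : Sigma a -> Sigma b -> sep_le a b -> side a v -> side b v.
  move=> Sa Sb ab; have [U <-] := surj v.
  by rewrite -!dual_embeddingP// => Ua; exact: (uf_le (dual_uf U) Ua Sb ab).
have Sfs := Sigma_flip Sigma_sys Ss; have Sft := Sigma_flip Sigma_sys St.
move=> /nestedP[le|[le|[le|le]]].
- exact/ty/(mono _ _ _ Ss St le).
- exact/sz/(mono _ _ _ St Ss le).
- by have /sideF := mono _ _ _ Ss Sft le sx; apply.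
- by apply: sw; apply: (mono _ _ _ Sft Ss le); apply/sideF.
Qed.

End DualEmbedding.

Theorem theorem1p2 (G : sgraph) (Sigma : set (separation G))
    (Sigma_sys : sep_system Sigma)
    (Sigma_discrete : discrete_system Sigma)
    (Sigma_cf : crossing_finite Sigma)
    (Sigma_ECC : ECC Sigma)
    (N : sgraph) (alpha : N -> set G)
    (alpha_md : median_decomposition alpha)
    (alpha_reduced : reduced alpha)
    (alpha_Sigma : induced_seps alpha = Sigma) :
  exists phi : dual_graph Sigma -> N,
    [/\ median_embedding phi,
        forall U, alpha (phi U) = dual_bag U &
        (forall x : N, exists U, phi U = x) <-> crossing_faithful alpha].
Proof.
exists (dual_embedding alpha_md alpha_reduced alpha_Sigma Sigma_sys Sigma_cf); split.
- split.
  + exact: (dual_median alpha_md alpha_reduced alpha_Sigma).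
  + by case: alpha_md.
  + exact: dual_embedding_inj.
  + exact: dual_embedding_adj.
  + exact: dual_embedding_median.
- exact: dual_embedding_bag.
- exact: dual_embedding_surj.
Qed.
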